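(* Let $x_1,\dots,x_n$ be propositional variables, and let $\varphi \equiv \bigvee_{j=1}^m \big(\bigwedge_{t \in \mathcal{S}_{T_j}} x_t \wedge \bigwedge_{k \in \mathcal{S}_{K_j}} \neg x_k\big)$ be a strict disjunctive normal form (SDNF), where for each $j$, $\mathcal{S}_{T_j}\subseteq\{1,\dots,n\}$ is the set of the $T_j=|\mathcal{S}_{T_j}|$ indices of positive literals and $\mathcal{S}_{K_j}\subseteq\{1,\dots,n\}$ is the set of the $K_j=|\mathcal{S}_{K_j}|$ indices of negative literals of the $j$-th conjunctive clause. Let $0<\epsilon<1$. Then $\varphi$ is equivalent to the restricted Boltzmann machine with visible units $x_1,\dots,x_n\in\{0,1\}$, hidden units $h_1,\dots,h_m\in\{0,1\}$ (one for each conjunctive clause) and energy function $$E(\mathbf{x},\mathbf{h}) = -\sum_{j=1}^m h_j\Big(\sum_{t \in \mathcal{S}_{T_j}} x_t - \sum_{k \in \mathcal{S}_{K_j}} x_k - T_j + \epsilon\Big).$$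
   Context: A conjunctive clause is a conjunction of literals $\bigwedge_{t \in \mathcal{S}_T} x_t \wedge \bigwedge_{k \in \mathcal{S}_K} \neg x_k$. A disjunctive normal form (DNF) is a finite disjunction of conjunctive clauses. A strict DNF (SDNF) is a DNF in which, for every truth assignment, at most one single conjunctive clause is True. A restricted Boltzmann machine (RBM) with binary visible units $x_i\in\{0,1\}$ and binary hidden units $h_j\in\{0,1\}$ is a network characterised by an energy function of the form $E(\mathbf{x},\mathbf{h}) = -\sum_{i,j} w_{ij}x_ih_j - \sum_i a_i x_i - \sum_j b_j h_j$ with real weights $w_{ij}$ and real biases $a_i,b_j$. Its energy ranking function is $E_{rank}(\mathbf{x})=\min_{\mathbf{h}}E(\mathbf{x},\mathbf{h})$, minimised over all values in $\{0,1\}$ of the hidden units. Truth values are identified with numbers by True $\equiv 1$, False $\equiv 0$, and $s_\varphi(\mathbf{x})\in\{0,1\}$ denotes the truth value of the formula $\varphi$ under the truth assignment $\mathbf{x}$. A formula $\varphi$ is equivalent to a network $\mathcal{N}$ with energy ranking function $E_{rank}$ if and only if there are constants $A>0$ and $B$ such that for every truth assignment $\mathbf{x}$, $s_\varphi(\mathbf{x}) = -A\,E_{rank}(\mathbf{x})+B$. *)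

(* Defs.v *)
From HB Require Import structures.
From mathcomp Require Import all_boot all_order all_algebra.
From mathcomp Require Import reals.
Set Implicit Arguments.
Unset Strict Implicit.
Unset Printing Implicit Defensive.
Import Order.TTheory GRing.Theory Num.Theory.
Local Open Scope ring_scope.

Inductive formula (n : nat) : Type :=
  | FTrue
  | FFalse
  | FVar of 'I_n
  | FNot of formula n
  | FAnd of formula n & formula n
  | FOr of formula n & formula n.

Arguments FTrue {n}.
Arguments FFalse {n}.

Definition assignment (n : nat) := {ffun 'I_n -> bool}.

Fixpoint truth n (phi : formula n) (x : assignment n) : bool :=
  match phi with
  | FTrue => true
  | FFalse => false
  | FVar i => x i
  | FNot p => ~~ truth p x
  | FAnd p q => truth p x && truth q x
  | FOr p q => truth p x || truth q x
  end.

(* The sets T and K may be empty (an empty conjunction is FTrue) and need not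
   be disjoint. *)
Definition clause n (T K : {set 'I_n}) : formula n :=
  FAnd (\big[@FAnd n/FTrue]_(t in T) FVar t)
       (\big[@FAnd n/FTrue]_(k in K) FNot (FVar k)).

Definition dnf n m (T K : 'I_m -> {set 'I_n}) : formula n :=
  \big[@FOr n/FFalse]_(j < m) clause (T j) (K j).

(* Clauses are counted by index: a satisfiable clause that is listed twice
   violates strictness. *)
Definition strict_dnf n m (T K : 'I_m -> {set 'I_n}) : Prop :=
  forall (x : assignment n) (i j : 'I_m),
    truth (clause (T i) (K i)) x -> truth (clause (T j) (K j)) x -> i = j.

Record rbm (R : realType) (n m : nat) : Type := RBM {
  weight : 'I_n -> 'I_m -> R;
  vbias : 'I_n -> R;
  hbias : 'I_m -> R
}.

(* The states of the binary units are Boolean vectors, read as 0 or 1 in R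
   through the coercion from bool to nat. *)
Definition energy (R : realType) n m (N : rbm R n m)
    (x : assignment n) (h : {ffun 'I_m -> bool}) : R :=
  - (\sum_(i < n) \sum_(j < m) weight N i j * (x i)%:R * (h j)%:R)
  - (\sum_(i < n) vbias N i * (x i)%:R)
  - (\sum_(j < m) hbias N j * (h j)%:R).

(* The all-false state only witnesses that the minimum is over a nonempty
   set. *)
Definition energy_rank (R : realType) n m (N : rbm R n m)
    (x : assignment n) : R :=
  energy N x [arg min_(h < [ffun=> false] : {ffun 'I_m -> bool}) energy N x h]%O.

Definition equivalent (R : realType) n m (phi : formula n) (N : rbm R n m)
    : Prop :=
  exists A B : R, 0 < A /\
    forall x : assignment n, (truth phi x)%:R = - A * energy_rank N x + B.

(* Main.v *)
(** The factor of [h_j] in [- E] is [eps - p], where [p] is the number of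
    literals of the [j]-th clause falsified by [x]. It equals [eps] when the
    clause is true and is negative otherwise, so the minimum over [h] is reached
    by switching on exactly the units of the true clauses; strictness leaves at
    most one of them, and the minimum is [- eps] times the truth value of the
    formula. *)
Require Import Defs.
From HB Require Import structures.
From mathcomp Require Import all_boot all_order all_algebra.
From mathcomp Require Import reals.
Set Implicit Arguments.
Unset Strict Implicit.
Unset Printing Implicit Defensive.
Import Order.TTheory GRing.Theory Num.Theory.
Local Open Scope ring_scope.

Lemma truth_bigFAnd n (I : finType) (P : pred I) (F : I -> formula n)
    (x : assignment n) :
  truth (\big[@FAnd n/FTrue]_(i | P i) F i) x = [forall (i | P i), truth (F i) x].
Proof. by rewrite -big_andE; apply: (big_morph (fun phi => truth phi x)). Qed.

Lemma truth_dnf n m (T K : 'I_m -> {set 'I_n}) (x : assignment n) :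
  truth (dnf T K) x = [exists j, truth (clause (T j) (K j)) x].
Proof.
rewrite /dnf (big_morph (fun phi => truth phi x) (id1 := false) (op1 := orb)) //.
by rewrite big_orE; apply: eq_existsb.
Qed.

(** Strictness leaves at most one nonzero summand, so the disjunction becomes an ordinary sum. *)
Lemma truth_strict_dnf (R : pzSemiRingType) n m (T K : 'I_m -> {set 'I_n})
    (x : assignment n) : strict_dnf T K ->
  (truth (dnf T K) x)%:R = \sum_(j < m) (truth (clause (T j) (K j)) x)%:R :> R.
Proof.
move=> strictTK; rewrite truth_dnf.
case: existsP => [[j xj]|noj].
  rewrite (bigD1 j) // big1 => [|i]; first by rewrite xj [RHS]addr0.
  apply: contra_neq_eq.
  by case xi: (truth _ x); rewrite ?eqxx // => _; apply: strictTK xi xj.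
by rewrite big1 // => j _; case xj: (truth _ x) => //; case: noj; exists j.
Qed.

(** An index in both [T] and [K] contributes exactly 1 for every [x], so contradictory clauses need
    no separate treatment. *)
Definition falsified n (T K : {set 'I_n}) (x : assignment n) : nat :=
  (\sum_(t in T) ~~ x t + \sum_(k in K) x k)%N.

Lemma falsified_eq0 n (T K : {set 'I_n}) (x : assignment n) :
  (falsified T K x == 0)%N = truth (clause T K) x.
Proof.
rewrite addn_eq0 !sum_nat_eq0 /= !truth_bigFAnd.
by congr (_ && _); apply: eq_forallb => i /=; rewrite eqb0 ?negbK.
Qed.

Definition clause_gain (R : realType) n (T K : {set 'I_n}) (eps : R)
    (x : assignment n) : R :=
  \sum_(t in T) (x t)%:R - \sum_(k in K) (x k)%:R - #|T|%:R + eps.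

Lemma clause_gain_falsified (R : realType) n (T K : {set 'I_n}) (eps : R)
    (x : assignment n) :
  clause_gain T K eps x = eps - (falsified T K x)%:R.
Proof.
rewrite /clause_gain /falsified.
have -> : #|T|%:R = \sum_(t in T) (x t)%:R + (\sum_(t in T) ~~ x t)%:R :> R.
  rewrite natr_sum -big_split /= -sum1_card natr_sum.
  by apply: eq_bigr => t _; case: (x t); rewrite ?addr0 ?add0r.
rewrite natrD (natr_sum _ _ _ (fun k => nat_of_bool (x k))).
by rewrite addrC opprD addrACA subrr add0r -opprD [X in - X]addrC.
Qed.

(** The number of falsified literals is an integer: once nonzero it is at least 1, hence exceeds
    [eps]. *)
Lemma max0_clause_gain (R : realType) n (T K : {set 'I_n}) (eps : R)
    (x : assignment n) : 0 < eps < 1 ->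
  Num.max 0 (clause_gain T K eps x) = (truth (clause T K) x)%:R * eps.
Proof.
case/andP=> eps_gt0 eps_lt1; rewrite clause_gain_falsified -falsified_eq0.
case: (falsified T K x) => [|p]; first by rewrite subr0 mul1r max_r ?ltW.
rewrite mul0r max_l // subr_le0 (le_trans (ltW eps_lt1)) //.
by rewrite ler1n.
Qed.

Lemma energy_rank_eq (R : realType) n m (N : rbm R n m) (x : assignment n)
    (h0 : {ffun 'I_m -> bool}) :
  (forall h, energy N x h0 <= energy N x h) ->
  energy_rank N x = energy N x h0.
Proof.
move=> h0min; rewrite /energy_rank; case: arg_minP => // h _ hmin.
by apply/le_anti; rewrite hmin ?h0min.
Qed.

(** Such an energy has no coupling between hidden units, so each [h j] can be optimised on its
    own. *)
Lemma energy_rank_max0 (R : realType) n m (N : rbm R n m) (x : assignment n)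
    (g : 'I_m -> R) :
  (forall h, energy N x h = - \sum_(j < m) (h j)%:R * g j) ->
  energy_rank N x = - \sum_(j < m) Num.max 0 (g j).
Proof.
(* The tie [g j = 0] may go either way, since both states of the unit then contribute 0. *)
move=> NE; pose h0 : {ffun 'I_m -> bool} := [ffun j => 0 <= g j].
have h0E : energy N x h0 = - \sum_(j < m) Num.max 0 (g j).
  rewrite NE; congr (- _); apply: eq_bigr => j _; rewrite ffunE.
  by case: leP => _; rewrite ?mul1r ?mul0r.
rewrite -h0E; apply: energy_rank_eq => h.
rewrite h0E NE lerN2; apply: ler_sum => j _.
by case: (h j); rewrite ?mul1r ?mul0r le_max lexx ?orbT.
Qed.

Definition clause_rbm (R : realType) n m (T K : 'I_m -> {set 'I_n}) (eps : R)
    : rbm R n m :=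
  RBM (fun i j => (i \in T j)%:R - (i \in K j)%:R) (fun=> 0)
      (fun j => eps - #|T j|%:R).

Lemma energy_clause_rbm (R : realType) n m (T K : 'I_m -> {set 'I_n}) (eps : R)
    (x : assignment n) (h : {ffun 'I_m -> bool}) :
  energy (clause_rbm T K eps) x h =
  - \sum_(j < m) (h j)%:R * clause_gain (T j) (K j) eps x.
Proof.
rewrite /energy /= [X in _ - X - _]big1 => [|i _]; last by rewrite mul0r.
rewrite subr0 -opprD exchange_big -big_split /=; congr (- _).
apply: eq_bigr => j _.
rewrite -mulr_suml -mulrDl mulrC /clause_gain -[in RHS]addrA [- _ + eps]addrC.
congr (_ * (_ + _)).
(* Both sums are extended to all visible units, to be compared term by term with the weights; on
   [T j] and [K j] overlapping, both sides cancel to 0. *)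
rewrite [in RHS]big_mkcond [X in _ = _ - X]big_mkcond /= -sumrB.
apply: eq_bigr => i _; rewrite mulrBl.
by case: (i \in T j); case: (i \in K j); rewrite ?mul1r ?mul0r.
Qed.

Theorem theorem1 (R : realType) (n m : nat) (T K : 'I_m -> {set 'I_n})
    (eps : R) (Hstrict : strict_dnf T K) (Heps : 0 < eps < 1) :
  exists N : rbm R n m,
    (forall (x : assignment n) (h : {ffun 'I_m -> bool}),
       energy N x h =
       - \sum_(j < m) (h j)%:R *
           (\sum_(t in T j) (x t)%:R - \sum_(k in K j) (x k)%:R
            - #|T j|%:R + eps))
    /\ equivalent (dnf T K) N.
Proof.
exists (clause_rbm T K eps); split; first exact: energy_clause_rbm.
have /andP[eps_gt0 _] := Heps.
exists eps^-1, 0; split=> [|x]; first by rewrite invr_gt0.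
rewrite (energy_rank_max0 (energy_clause_rbm T K eps x)) addr0 mulrNN.
under eq_bigr => j _ do rewrite max0_clause_gain //.
by rewrite -mulr_suml mulrC mulfK ?gt_eqF // truth_strict_dnf.
Qed.
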